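(* Let $G$ be a finite group and let $A$ be a $G$-$C^*$-algebra. Let $q_0\in\operatorname{Proj}(A)$ be a projection which is fixed by $G$. Let $$\Xi\colon\operatorname{Aut}(A)\to\operatorname{Proj}_I(A),\qquad\beta\mapsto\beta(q_0),$$ where $I\subseteq\pi_0(\operatorname{Proj}(A))$ is the image of the map induced on $\pi_0$ by $\beta\mapsto\beta(q_0)$. Then $\Xi$ is a Hurewicz $G$-fibration, where $G$ acts on the domain by conjugation.
   Context: $\operatorname{Proj}(A)\subset A$ is the space of projections with the norm topology and the restricted $G$-action; for $I\subseteq\pi_0(\operatorname{Proj}(A))$, $\operatorname{Proj}_I(A)$ is the subspace of projections whose path component lies in $I$. $\operatorname{Aut}(A)$ is the group of $*$-automorphisms of $A$ with the point-norm topology, and $g\in G$ acts on it by $\beta\mapsto\alpha_g\circ\beta\circ\alpha_g^{-1}$, where $\alpha$ is the $G$-action on $A$. A Hurewicz $G$-fibration is a $G$-map with the $G$-equivariant homotopy lifting property with respect to all $G$-spaces. *)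

(* Defs.v *)
From HB Require Import structures.
From mathcomp Require Import all_boot all_order all_fingroup all_algebra.
From mathcomp Require Import generic_quotient complex lra.
From mathcomp Require Import all_classical reals topology normedtype homotopy.

Set Implicit Arguments.
Unset Strict Implicit.
Unset Printing Implicit Defensive.

Import Order.TTheory GRing.Theory Num.Theory.
Import numFieldNormedType.Exports.

Local Open Scope classical_set_scope.
Local Open Scope ring_scope.

Section UnitInterval.
Context (R : realType).

Definition unitI : Type := set_type (`[0, 1]%classic : set R).
HB.instance Definition _ := Topological.on unitI.

Fact unitI0_subproof : (0 : R) \in (`[0, 1]%classic : set R).
Proof. by apply/mem_set; rewrite /= in_itv /= lexx ler01. Qed.

Fact unitI1_subproof : (1 : R) \in (`[0, 1]%classic : set R).
Proof. by apply/mem_set; rewrite /= in_itv /= lexx ler01. Qed.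

Definition unitI0 : unitI := exist _ 0 unitI0_subproof.
Definition unitI1 : unitI := exist _ 1 unitI1_subproof.

Fact unitI01_neq : unitI0 != unitI1.
Proof.
by apply/eqP => /(congr1 val) /= /eqP; rewrite eq_sym oner_eq0.
Qed.

HB.instance Definition _ := isBiPointed.Build unitI unitI01_neq.

Lemma unitI_val_continuous : continuous (val : unitI -> R).
Proof. exact: (@initial_continuous _ _ (set_val : unitI -> R)). Qed.

Lemma continuous_to_unitI (X : topologicalType) (f : X -> unitI) :
  continuous (val \o f) -> continuous f.
Proof. exact: (@continuous_comp_initial _ X _ (set_val : unitI -> R)). Qed.

Fact clamp_subproof (t : R) :
  (1 + `|t| - `|1 - t|) / 2 \in (`[0, 1]%classic : set R).
Proof.
apply/mem_set; rewrite /= in_itv /=.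
have n1 := ler_norm t; have n2 := ler_norm (1 - t).
have d1 := ler_normB 1 (1 - t); have d2 := ler_normB 1 t.
rewrite normr1 subKr in d1; rewrite normr1 in d2.
apply/andP; split; lra.
Qed.

(* The retraction of the real line onto the unit interval. *)
Definition clamp (t : R) : unitI :=
  exist _ ((1 + `|t| - `|1 - t|) / 2) (clamp_subproof t).

Lemma clampK (t : R) : 0 <= t <= 1 -> val (clamp t) = t.
Proof.
by move=> /andP[t0 t1] /=; rewrite ger0_norm// ger0_norm ?subr_ge0//; lra.
Qed.

Lemma clamp_continuous : continuous clamp.
Proof.
apply: continuous_to_unitI => t.
apply: cvgM; last exact: cvg_cst.
apply: cvgB.
  apply: cvgD; first exact: cvg_cst.
  exact: norm_continuous.
by apply: cvg_norm; apply: cvgB; [exact: cvg_cst|exact: cvg_id].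
Qed.

End UnitInterval.

Section Pi0.
Context (R : realType).

Definition path_connected (X : topologicalType) (x y : X) : bool :=
  `[< $|{path unitI R from x to y}| >].

Lemma path_connectedP (X : topologicalType) (x y : X) :
  reflect (exists f : unitI R -> X, [/\ continuous f, f zero = x & f one = y])
          (path_connected x y).
Proof.
apply: (iffP (asboolP _)) => [[p]|[f [cf f0 f1]]].
  by exists p; split; [exact: cts_fun|exact: path_zero|exact: path_one].
exact: (squash (mk_path cf f0 f1 : {path unitI R from x to y})).
Qed.

Lemma path_connected_refl (X : topologicalType) :
  reflexive (@path_connected X).
Proof.
move=> x; apply/path_connectedP; exists (cst x); split=> //.
exact: cst_continuous.
Qed.

Let path_connected_flip (X : topologicalType) (x y : X) :
  path_connected x y -> path_connected y x.
Proof.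
move=> /path_connectedP[f [cf f0 f1]]; apply/path_connectedP.
exists (fun s : unitI R => f (clamp (1 - val s))); split.
- have c1 : continuous (fun t : R => 1 - t).
    by move=> t; apply: cvgB; [exact: cvg_cst|exact: cvg_id].
  move=> s; apply: (@continuous_comp (unitI R) R _ (val : unitI R -> R)
    (fun t : R => f (clamp (1 - t)))).
    exact: unitI_val_continuous.
  apply: (@continuous_comp R (unitI R) _ (fun t => clamp (1 - t)) f).
    apply: (@continuous_comp R R _ (fun t => 1 - t) (@clamp R)).
      exact: c1.
    exact: clamp_continuous.
  exact: cf.
- rewrite -f1; congr f; apply: val_inj; rewrite clampK /= ?subr0//.
  by rewrite ler01 lexx.
- rewrite -f0; congr f; apply: val_inj; rewrite clampK /= ?subrr//.
  by rewrite ler01 lexx.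
Qed.

Lemma path_connected_sym (X : topologicalType) :
  symmetric (@path_connected X).
Proof. by move=> x y; apply/idP/idP; exact: path_connected_flip. Qed.

Lemma path_connected_trans (X : topologicalType) :
  transitive (@path_connected X).
Proof.
move=> y x z /path_connectedP[f [cf f0 f1]] /path_connectedP[g [cg g0 g1]].
pose F (t : R) := f (clamp (2 * t)); pose G (t : R) := g (clamp (2 * t - 1)).
have cF : continuous F.
  move=> t; apply: (@continuous_comp R (unitI R) _ (fun t => clamp (2 * t)) f).
    apply: (@continuous_comp R R _ (fun t => 2 * t) (@clamp R)).
      exact: mulrl_continuous.
    exact: clamp_continuous.
  exact: cf.
have cG : continuous G.
  move=> t.
  apply: (@continuous_comp R (unitI R) _ (fun t => clamp (2 * t - 1)) g).
    apply: (@continuous_comp R R _ (fun t => 2 * t - 1) (@clamp R)).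
      by apply: cvgB; [exact: mulrl_continuous|exact: cvg_cst].
    exact: clamp_continuous.
  exact: cg.
have FG : F 2^-1 = G 2^-1.
  rewrite /F /G divff ?pnatr_eq0// subrr.
  have -> : clamp (1 : R) = one.
    by apply: val_inj; rewrite clampK// ler01 lexx.
  have -> : clamp (0 : R) = zero.
    by apply: val_inj; rewrite clampK// ler01 lexx.
  by rewrite f1 g0.
pose h (t : R) := if t <= 2^-1 then F t else G t.
have ch : continuous h.
  apply/continuous_subspace_setT.
  have -> : [set: R] = `]-oo, 2^-1] `|` `[2^-1, +oo[.
    apply/seteqP; split=> // t _ /=; rewrite !in_itv /= andbT.
    by case: (lerP t 2^-1) => [|/ltW]; [left|right].
  apply: withinU_continuous; [exact: lray_closed|exact: rray_closed| |].
  - apply: (@subspace_eq_continuous _ _ _ F); last exact: continuous_subspaceT.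
    move=> t /set_mem; rewrite /= in_itv /= => t2.
    by rewrite /from_subspace /h t2.
  - apply: (@subspace_eq_continuous _ _ _ G); last exact: continuous_subspaceT.
    move=> t /set_mem; rewrite /= in_itv /= andbT => t2.
    rewrite /from_subspace /h; case: (lerP t 2^-1) => // t2'.
    have -> : t = 2^-1 by apply/eqP; rewrite eq_le t2 t2'.
    by rewrite FG.
apply/path_connectedP; exists (h \o val); split.
- move=> s; apply: (@continuous_comp (unitI R) R _ (val : unitI R -> R) h).
    exact: unitI_val_continuous.
  exact: ch.
- rewrite /h /= invr_ge0 ler0n -f0 /F; congr f; apply: val_inj.
  by rewrite mulr0 clampK// lexx ler01.
- rewrite /h /= ifF; last by apply/negbTE; rewrite -ltNge; lra.
  rewrite -g1 /G; congr g; apply: val_inj.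
  by rewrite clampK /=; lra.
Qed.

Canonical path_connected_equiv (X : topologicalType) :=
  EquivRel (@path_connected X) (@path_connected_refl X)
    (@path_connected_sym X) (@path_connected_trans X).

Definition pi0 (X : topologicalType) : Type :=
  {eq_quot (@path_connected_equiv X)}%qT.
HB.instance Definition _ (X : topologicalType) := Quotient.on (pi0 X).

Definition pi0_class (X : topologicalType) (x : X) : pi0 X :=
  (\pi_(pi0 X) x)%qT.

Lemma pi0_classP (X : topologicalType) (x y : X) :
  pi0_class x = pi0_class y <-> path_connected x y.
Proof. by split=> [/eqmodP|/eqmodP]. Qed.

Definition pi0_map (X Y : topologicalType) (f : continuousType X Y) :
  pi0 X -> pi0 Y := fun c => pi0_class (f (repr c)).

Lemma pi0_mapE (X Y : topologicalType) (f : continuousType X Y) (x : X) :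
  pi0_map f (pi0_class x) = pi0_class (f x).
Proof.
apply/pi0_classP.
have /pi0_classP/path_connectedP[p [cp p0 p1]] :
    pi0_class (repr (pi0_class x)) = pi0_class x by exact: reprK.
apply/path_connectedP; exists (f \o p); rewrite /= p0 p1; split=> // s.
by apply: continuous_comp; [exact: cp|exact: cts_fun].
Qed.

End Pi0.

(* As G is finite, hence discrete, joint continuity of the action amounts to
   continuity of each translation. *)
HB.mixin Record isGSpace (gT : finGroupType) X of Topological X := {
  gsact : gT -> X -> X;
  gsact1 : forall x, gsact 1%g x = x;
  gsactM : forall g h x, gsact (g * h)%g x = gsact g (gsact h x);
  gsact_continuous : forall g, continuous (gsact g)
}.

#[short(type="gSpaceType")]
HB.structure Definition GSpace (gT : finGroupType) :=
  {X of isGSpace gT X & Topological X}.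

Section GFibration.
Context (gT : finGroupType).

Lemma gsactK (X : gSpaceType gT) (g : gT) :
  cancel (@gsact gT X g) (gsact g^-1%g).
Proof. by move=> x; rewrite -gsactM mulVg gsact1. Qed.

Lemma gsactVK (X : gSpaceType gT) (g : gT) :
  cancel (@gsact gT X g^-1%g) (gsact g).
Proof. by move=> x; rewrite -gsactM mulgV gsact1. Qed.

Definition is_gmap (X Y : gSpaceType gT) (f : X -> Y) : Prop :=
  continuous f /\ forall (g : gT) (x : X), f (gsact g x) = gsact g (f x).

(* X x [0, 1], with G acting trivially on [0, 1]. *)
Definition cylinder (R : realType) (X : gSpaceType gT) : Type :=
  (X * unitI R)%type.
HB.instance Definition _ (R : realType) (X : gSpaceType gT) :=
  Topological.on (cylinder R X).

Section CylinderAction.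
Context (R : realType) (X : gSpaceType gT).

Definition cylinder_act (g : gT) (z : cylinder R X) : cylinder R X :=
  (gsact g z.1, z.2).

Fact cylinder_act1 z : cylinder_act 1%g z = z.
Proof. by case: z => x t; rewrite /cylinder_act gsact1. Qed.

Fact cylinder_actM g h z :
  cylinder_act (g * h)%g z = cylinder_act g (cylinder_act h z).
Proof. by rewrite /cylinder_act gsactM. Qed.

Fact cylinder_act_continuous g : continuous (cylinder_act g).
Proof.
have c1 : continuous (fun z : X * unitI R => gsact g z.1).
  move=> z; apply: (@continuous_comp (X * unitI R)%type X X fst (gsact g)).
    exact: cvg_fst.
  exact: gsact_continuous.
by move=> z; exact: cvg_pair (c1 z) cvg_snd.
Qed.

HB.instance Definition _ := isGSpace.Build gT (cylinder R X)
  cylinder_act1 cylinder_actM cylinder_act_continuous.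
End CylinderAction.

Definition is_hurewicz_gfibration (R : realType) (E B : gSpaceType gT)
    (p : E -> B) : Prop :=
  is_gmap p /\
  forall (X : gSpaceType gT) (f : X -> E) (H : cylinder R X -> B),
    is_gmap f -> is_gmap H -> (forall x, H (x, zero) = p (f x)) ->
    exists K : cylinder R X -> E,
      [/\ is_gmap K, forall x, K (x, zero) = f x & forall z, p (K z) = H z].

End GFibration.

(* Complex C*-algebras, not assumed to be unital. MathComp rings have a unit,
   hence the separate operation cmul. *)
HB.mixin Record isCStarAlgebra (R : realType) A
    of CompleteNormedModule R[i] A := {
  cmul : A -> A -> A;
  cstar : A -> A;
  cmulA : associative cmul;
  cmulDl : left_distributive cmul +%R;
  cmulDr : right_distributive cmul +%R;
  cmulZl : forall (l : R[i]) (x y : A), cmul (l *: x) y = l *: cmul x y;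
  cmulZr : forall (l : R[i]) (x y : A), cmul x (l *: y) = l *: cmul x y;
  cmul_norm : forall x y : A, `|cmul x y| <= `|x| * `|y|;
  cstarK : involutive cstar;
  cstarD : {morph cstar : x y / x + y};
  cstarZ : forall (l : R[i]) (x : A), cstar (l *: x) = l^* *: cstar x;
  cstarM : forall x y : A, cstar (cmul x y) = cmul (cstar y) (cstar x);
  cstar_norm : forall x : A, `|cmul (cstar x) x| = `|x| ^+ 2
}.

#[short(type="cstarAlgType")]
HB.structure Definition CStarAlgebra (R : realType) :=
  {A of isCStarAlgebra R A & CompleteNormedModule R[i] A}.

Definition is_star_automorphism (R : realType) (A : cstarAlgType R)
    (f : A -> A) : Prop :=
  [/\ linear f, {morph f : x y / cmul x y}, {morph f : x / cstar x}
    & bijective f].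

HB.mixin Record isGCStarAlgebra (R : realType) (gT : finGroupType) A
    of CStarAlgebra R A & GSpace gT A := {
  gsact_star_automorphism :
    forall g : gT, is_star_automorphism (gsact g : A -> A)
}.

#[short(type="gcstarAlgType")]
HB.structure Definition GCStarAlgebra (R : realType) (gT : finGroupType) :=
  {A of isGCStarAlgebra R gT A & CStarAlgebra R A & GSpace gT A}.

Definition Proj (R : realType) (A : cstarAlgType R) : Type :=
  set_type [set p : A | cmul p p = p /\ cstar p = p].
HB.instance Definition _ (R : realType) (A : cstarAlgType R) :=
  Topological.on (Proj A).

(* The topology of pointwise convergence of maps A -> A for the norm topology of
   A induces the point-norm topology. *)
Definition StarAut (R : realType) (A : cstarAlgType R) : Type :=
  set_type [set f : {ptws A -> A} | is_star_automorphism f].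
HB.instance Definition _ (R : realType) (A : cstarAlgType R) :=
  Topological.on (StarAut A).

Section ProjAut.
Context (R : realType) (A : cstarAlgType R).

Definition proj_val (p : Proj A) : A := val p.
Definition aut_val (b : StarAut A) : A -> A := val b.

Lemma projP (p : Proj A) :
  cmul (proj_val p) (proj_val p) = proj_val p /\
  cstar (proj_val p) = proj_val p.
Proof. exact: (set_mem (valP p)). Qed.

Lemma autP (b : StarAut A) : is_star_automorphism (aut_val b).
Proof. exact: (set_mem (valP b)). Qed.

Lemma proj_inj : injective proj_val. Proof. exact: val_inj. Qed.
Lemma aut_inj : injective aut_val. Proof. exact: val_inj. Qed.

Lemma proj_val_continuous : continuous proj_val.
Proof. exact: (@initial_continuous _ _ (set_val : Proj A -> A)). Qed.

Lemma continuous_to_proj (X : topologicalType) (f : X -> Proj A) :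
  continuous (proj_val \o f) -> continuous f.
Proof. exact: (@continuous_comp_initial _ X _ (set_val : Proj A -> A)). Qed.

Lemma aut_eval_continuous (a : A) :
  continuous (fun b : StarAut A => aut_val b a).
Proof.
move=> b.
apply: (@continuous_comp (StarAut A) {ptws A -> A} A aut_val (proj a)).
  exact: (@initial_continuous _ _ (set_val : StarAut A -> {ptws A -> A})).
exact: proj_continuous.
Qed.

Lemma continuous_to_aut (X : topologicalType) (f : X -> StarAut A) :
  (forall a, continuous (fun x => aut_val (f x) a)) -> continuous f.
Proof.
move=> cf; apply: (@continuous_comp_initial _ X _
  (set_val : StarAut A -> {ptws A -> A})).
by move=> x; apply/pointwise_cvgP => a; exact: cf.
Qed.

Fact star_automorphism_proj (f : A -> A) (p : Proj A) :
  is_star_automorphism f ->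
  f (proj_val p) \in [set p : A | cmul p p = p /\ cstar p = p].
Proof.
case=> _ fM fS _; have [pp ps] := projP p.
by apply/mem_set; split; rewrite -?fM -?fS ?pp ?ps.
Qed.

Definition aut_app (f : A -> A) (fP : is_star_automorphism f) (p : Proj A) :
  Proj A := exist _ (f (proj_val p)) (star_automorphism_proj p fP).

Definition ev_proj (q : Proj A) (b : StarAut A) : Proj A := aut_app (autP b) q.

Fact ev_proj_continuous (q : Proj A) : continuous (ev_proj q).
Proof. by apply: continuous_to_proj; exact: aut_eval_continuous. Qed.

HB.instance Definition _ (q : Proj A) :=
  isContinuous.Build (StarAut A) (Proj A) (ev_proj q) (@ev_proj_continuous q).

Definition Proj_sub (I : set (pi0 R (Proj A))) : Type :=
  set_type [set p : Proj A | I (pi0_class R p)].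
HB.instance Definition _ (I : set (pi0 R (Proj A))) :=
  Topological.on (Proj_sub I).

Definition ev_pi0_image (q : Proj A) : set (pi0 R (Proj A)) :=
  range (pi0_map (ev_proj q)).

Fact ev_proj_ev_pi0_image (q : Proj A) (b : StarAut A) :
  ev_proj q b \in [set p : Proj A | ev_pi0_image q (pi0_class R p)].
Proof.
by apply/mem_set; exists (pi0_class R b) => //; rewrite pi0_mapE.
Qed.

Definition Xi (q : Proj A) (b : StarAut A) : Proj_sub (ev_pi0_image q) :=
  exist _ (ev_proj q b) (ev_proj_ev_pi0_image q b).

End ProjAut.

Section GActions.
Context (R : realType) (gT : finGroupType) (A : gcstarAlgType R gT).

Definition proj_act (g : gT) (p : Proj A) : Proj A :=
  aut_app (gsact_star_automorphism g) p.

Fact proj_act1 p : proj_act 1%g p = p.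
Proof. by apply: proj_inj; exact: gsact1. Qed.

Fact proj_actM g h p : proj_act (g * h)%g p = proj_act g (proj_act h p).
Proof. by apply: proj_inj; exact: gsactM. Qed.

Fact proj_act_continuous g : continuous (proj_act g).
Proof.
apply: continuous_to_proj => p.
apply: (@continuous_comp (Proj A) A A (@proj_val R A) (gsact g)).
  exact: proj_val_continuous.
exact: gsact_continuous.
Qed.

HB.instance Definition _ := isGSpace.Build gT (Proj A)
  proj_act1 proj_actM proj_act_continuous.

Fact conj_subproof (g : gT) (b : StarAut A) :
  (gsact g \o aut_val b \o gsact g^-1%g) \in
    [set f : {ptws A -> A} | is_star_automorphism f].
Proof.
apply/mem_set.
have [l1 m1 s1 b1] : is_star_automorphism (gsact g : A -> A).
  exact: gsact_star_automorphism.
have [l2 m2 s2 b2] := autP b.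
have [l3 m3 s3 b3] : is_star_automorphism (gsact g^-1%g : A -> A).
  exact: gsact_star_automorphism.
split.
- by move=> k x y /=; rewrite l3 l2 l1.
- by move=> x y /=; rewrite m3 m2 m1.
- by move=> x /=; rewrite s3 s2 s1.
- by apply: bij_comp b3; exact: bij_comp b1 b2.
Qed.

Definition aut_act (g : gT) (b : StarAut A) : StarAut A :=
  exist _ (gsact g \o aut_val b \o gsact g^-1%g) (conj_subproof g b).

Fact aut_act1 b : aut_act 1%g b = b.
Proof.
by apply: aut_inj; apply/funext => a; rewrite /aut_val /= invg1 !gsact1.
Qed.

Fact aut_actM g h b : aut_act (g * h)%g b = aut_act g (aut_act h b).
Proof.
by apply: aut_inj; apply/funext => a; rewrite /aut_val /= invMg !gsactM.
Qed.

Fact aut_act_continuous g : continuous (aut_act g).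
Proof.
apply: continuous_to_aut => a b.
apply: (@continuous_comp (StarAut A) A A
  (fun b => aut_val b (gsact g^-1%g a)) (gsact g)).
  exact: aut_eval_continuous.
exact: gsact_continuous.
Qed.

HB.instance Definition _ := isGSpace.Build gT (StarAut A)
  aut_act1 aut_actM aut_act_continuous.

Definition is_pi0_invariant (I : set (pi0 R (Proj A))) : Prop :=
  forall (g : gT) (p : Proj A),
    I (pi0_class R p) -> I (pi0_class R (gsact g p)).

(* Proj_I(A) is stable under G, hence a G-space, when I is G-invariant; the
   alias carries the proof of invariance needed by the canonical instance. *)
Definition GProj_sub (I : set (pi0 R (Proj A))) (I_inv : is_pi0_invariant I) :
  Type := Proj_sub I.
HB.instance Definition _ I I_inv := Topological.on (@GProj_sub I I_inv).

Section ProjSubAction.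
Context (I : set (pi0 R (Proj A))) (I_inv : is_pi0_invariant I).

Fact proj_sub_act_subproof (g : gT) (p : GProj_sub I_inv) :
  gsact g (val p) \in [set p : Proj A | I (pi0_class R p)].
Proof. by apply/mem_set; apply: I_inv; exact: (set_mem (valP p)). Qed.

Definition proj_sub_act (g : gT) (p : GProj_sub I_inv) : GProj_sub I_inv :=
  exist _ (gsact g (val p)) (proj_sub_act_subproof g p).

Fact proj_sub_act1 p : proj_sub_act 1%g p = p.
Proof. by apply: val_inj; exact: gsact1. Qed.

Fact proj_sub_actM g h p :
  proj_sub_act (g * h)%g p = proj_sub_act g (proj_sub_act h p).
Proof. by apply: val_inj; exact: gsactM. Qed.

Fact proj_sub_act_continuous g : continuous (proj_sub_act g).
Proof.
apply: (@continuous_comp_initial _ (GProj_sub I_inv) _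
  (set_val : Proj_sub I -> Proj A)) => p.
apply: (@continuous_comp (Proj_sub I) (Proj A) (Proj A)
  (set_val : Proj_sub I -> Proj A) (gsact g)).
  exact: (@initial_continuous _ _ (set_val : Proj_sub I -> Proj A)).
exact: gsact_continuous.
Qed.

HB.instance Definition _ := isGSpace.Build gT (GProj_sub I_inv)
  proj_sub_act1 proj_sub_actM proj_sub_act_continuous.
End ProjSubAction.

Lemma gsact_ev_proj (g : gT) (q : Proj A) (b : StarAut A) :
  gsact g q = q -> gsact g (ev_proj q b) = ev_proj q (gsact g b).
Proof.
move=> gq; apply: proj_inj => /=.
rewrite -[X in _ = aut_val _ (proj_val X)]gq.
by rewrite /aut_val /proj_val /= gsactK.
Qed.

Lemma ev_pi0_image_invariant (q : Proj A) :
  (forall g : gT, gsact g q = q) -> is_pi0_invariant (ev_pi0_image q).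
Proof.
move=> qG g p [c _]; rewrite -[c]reprK => cp.
exists (pi0_class R (gsact g (repr c))) => //.
have {}cp : pi0_class R (ev_proj q (repr c)) = pi0_class R p.
  by rewrite -cp -pi0_mapE.
rewrite pi0_mapE [X in pi0_class R X]/= -(gsact_ev_proj _ (qG g)).
move/pi0_classP/path_connectedP : cp => [f [cf f0 f1]].
apply/pi0_classP/path_connectedP; exists (gsact g \o f); rewrite /= f0 f1.
split=> // s; apply: (@continuous_comp (unitI R) (Proj A) (Proj A) f (gsact g)).
  exact: cf.
exact: gsact_continuous.
Qed.

End GActions.

(* Main.v *)
From HB Require Import structures.
Require Import Defs.
From mathcomp Require Import all_boot all_order all_fingroup all_algebra.
From mathcomp Require Import complex lra ring.
From mathcomp Require Import all_classical reals topology normedtype.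
Set Implicit Arguments.
Unset Strict Implicit.
Unset Printing Implicit Defensive.
Import Order.TTheory GRing.Theory Num.Theory.
Import numFieldNormedType.Exports.
Local Open Scope classical_set_scope.
Local Open Scope ring_scope.

(** The base [Proj_I(A)] is a metric space on which [G] acts by isometries, and
    nearby projections are joined by a canonical automorphism: if [p] and [q]
    are close, there is a unitary [u] with [u p u* = q] which depends
    continuously on [(p, q)], is [1] when [p = q], and is carried by each
    [alpha_g] to the unitary of [(alpha_g p, alpha_g q)]. A homotopy
    [H : X x [0, 1] -> Proj_I(A)] starting at [f(x)(q0)] is then lifted by
    transporting [q0] along the path [H(x, -)] in small steps: subdivide [0, t],
    and compose [f(x)] with the conjugations joining the values of [H(x, -)] at
    consecutive breakpoints. As everything is canonical, the lift is equivariant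
    as soon as the subdivision is.

    The space [X] is arbitrary, so that partitions of unity on [X] are not
    available. They are replaced by an explicit continuous step: the infimum
    over [(s, t)] of [max(|s - t|, eps - |H(x, s) - H(x, t)|)] is positive and
    continuous in [x] by compactness ([mesh_gt0], [mesh_continuous]), bounds
    from below the distance of any two times whose images are more than [eps]
    apart ([mesh_close]), and is [G]-invariant since it only involves distances
    in [A], which [G] preserves ([rnorm_gsact]). The breakpoints are the
    multiples of half of this step, truncated at [t]; beyond [t] all the
    conjugations are trivial, so that near each point the number of steps may be
    taken constant, whence continuity ([homotopy_lift_continuous]).

    The algebra [A] may have no unit. An element [1 + a] of its unitization is
    represented by [a], the product becoming the circle operation
    [a + b + a b]. With the symmetries [1 - 2 p] and [1 - 2 q], the unitary [u]
    is the square root close to [1] of [(1 - 2 q)(1 - 2 p)]: in the plane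
    spanned by two lines at angle [theta], this product is the rotation by
    [2 theta], and [u] is the rotation by [theta]. The square root is a fixed
    point of a contraction ([circ_sqrt_exists]), and all its properties come
    from uniqueness of small square roots ([circ_sqr_inj]): [u* u = 1]
    ([turn_unitary]), [u p u* = q] ([uconj_turn]), naturality
    ([gsact_rotate]), triviality for [p = q] ([turn_refl0]), and, in the quantitative form
    [ler_circ_sqr], continuity ([continuous_turn]). *)

(** * Real-valued norms *)

Section RealNorm.
Context (R : realType) (V : normedModType R[i]).
Implicit Types a b : V.

(** The norm of [V] takes its values in the partially ordered field [R[i]];
    infima and decision procedures need them in [R]. *)
Definition rnorm a : R := complex.Re `|a|.

Lemma rnormE a : `|a| = (rnorm a)%:C%C.
Proof.
have /ger0_Im : 0 <= `|a| by exact: normr_ge0.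
by rewrite /rnorm; case: `|a| => x y /= ->.
Qed.

Lemma rnorm_ge0 a : 0 <= rnorm a.
Proof. by rewrite -ler0c -rnormE. Qed.

Lemma rnorm0 : rnorm (0 : V) = 0.
Proof. by rewrite /rnorm normr0. Qed.

Lemma rnorm0_eq0 a : rnorm a = 0 -> a = 0.
Proof. by move=> a0; apply/normr0_eq0; rewrite rnormE a0. Qed.

Lemma rnormN a : rnorm (- a) = rnorm a.
Proof. by rewrite /rnorm normrN. Qed.

Lemma rnormB a b : rnorm (a - b) = rnorm (b - a).
Proof. by rewrite -opprB rnormN. Qed.

Lemma ler_rnormD a b : rnorm (a + b) <= rnorm a + rnorm b.
Proof. by rewrite -lecR rmorphD/= -!rnormE ler_normD. Qed.

Lemma ler_rnormB a b : rnorm (a - b) <= rnorm a + rnorm b.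
Proof. by rewrite -(rnormN b) ler_rnormD. Qed.

Lemma rnormMn a n : rnorm (a *+ n) = rnorm a *+ n.
Proof. by apply: complexI; rewrite rmorphMn/= -!rnormE normrMn. Qed.

Lemma rnormZ (r : R) a : rnorm (r%:C%C *: a) = `|r| * rnorm a.
Proof.
apply: complexI; rewrite rmorphM/= -!rnormE normrZ; congr (_ * _).
by rewrite normc_def/= expr0n addr0 sqrtr_sqr.
Qed.

Lemma ler_dist_rnorm a b : `|rnorm a - rnorm b| <= rnorm (a - b).
Proof.
have := ler_rnormD (a - b) b; have := ler_rnormD (b - a) a.
rewrite !subrK (rnormB b a) => h1 h2.
by rewrite ler_norml; apply/andP; split; lra.
Qed.

Lemma cvg_rnormP {T : Type} {F : set_system T} {FF : Filter F} (f : T -> V) a :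
  f x @[x --> F] --> a <->
  forall e : R, 0 < e -> \forall x \near F, rnorm (a - f x) < e.
Proof.
split=> [/cvgrPdist_lt fa e e0|fa].
  have e0' : 0 < e%:C%C by rewrite ltcR.
  by apply: filterS (fa _ e0') => x; rewrite rnormE ltcR.
apply/cvgrPdist_lt => -[e e'] /=; rewrite ltcE/= => /andP[/eqP -> e0].
by apply: filterS (fa _ e0) => x; rewrite rnormE ltcR.
Qed.

Lemma continuous_rnorm {X : topologicalType} (f : X -> V) :
  continuous f -> continuous (fun x => rnorm (f x)).
Proof.
move=> cf x; apply/cvgrPdist_lt => e e0.
move/cvg_rnormP: (cf x) => /(_ _ e0).
by apply: filterS => y; apply: le_lt_trans (ler_dist_rnorm _ _).
Qed.

End RealNorm.

(** * Elementary algebra and continuity in a C*-algebra *)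

Section CStarBasics.
Context (R : realType) (A : cstarAlgType R).
Implicit Types a b c m p q v w : A.
Local Notation "a ⋅ b" := (cmul a b) (at level 40, left associativity).

Lemma cmulNl a b : (- a) ⋅ b = - (a ⋅ b).
Proof. by rewrite -scaleN1r cmulZl scaleN1r. Qed.

Lemma cmulNr a b : a ⋅ (- b) = - (a ⋅ b).
Proof. by rewrite -scaleN1r cmulZr scaleN1r. Qed.

Lemma cmul0l a : 0 ⋅ a = 0.
Proof. by have := cmulZl 0 0 a; rewrite !scale0r. Qed.

Lemma cmul0r a : a ⋅ 0 = 0.
Proof. by have := cmulZr 0 a 0; rewrite !scale0r. Qed.

Lemma cmulMnl a b n : (a *+ n) ⋅ b = (a ⋅ b) *+ n.
Proof. by rewrite -scaler_nat cmulZl scaler_nat. Qed.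

Lemma cmulMnr a b n : a ⋅ (b *+ n) = (a ⋅ b) *+ n.
Proof. by rewrite -scaler_nat cmulZr scaler_nat. Qed.

Lemma cmulBl a b c : (a - b) ⋅ c = a ⋅ c - b ⋅ c.
Proof. by rewrite cmulDl cmulNl. Qed.

Lemma cmulBr a b c : a ⋅ (b - c) = a ⋅ b - a ⋅ c.
Proof. by rewrite cmulDr cmulNr. Qed.

Lemma cstarN a : cstar (- a) = - cstar a.
Proof. by rewrite -scaleN1r cstarZ rmorphN1 scaleN1r. Qed.

Lemma cstar0 : cstar (0 : A) = 0.
Proof. by rewrite -(scale0r (0 : A)) cstarZ rmorph0 !scale0r. Qed.

Lemma cstarMn a n : cstar (a *+ n) = cstar a *+ n.
Proof. by rewrite -scaler_nat cstarZ rmorph_nat scaler_nat. Qed.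

Lemma ler_rnormM a b : rnorm (a ⋅ b) <= rnorm a * rnorm b.
Proof. by rewrite -lecR rmorphM/= -!rnormE cmul_norm. Qed.

Lemma rnorm_cstarM a : rnorm (cstar a ⋅ a) = rnorm a ^+ 2.
Proof. by apply: complexI; rewrite rmorphXn/= -!rnormE cstar_norm. Qed.

Lemma rnorm_cstar a : rnorm (cstar a) = rnorm a.
Proof.
have H b : rnorm b <= rnorm (cstar b).
  have := ler_rnormM (cstar b) b; rewrite rnorm_cstarM expr2.
  have := rnorm_ge0 b; rewrite le_eqVlt => /predU1P[<- _|b0].
    exact: rnorm_ge0.
  by rewrite ler_pM2r.
by apply/eqP; rewrite eq_le -{2}(cstarK a) !H.
Qed.

Lemma continuous_cmul {X : topologicalType} (f g : X -> A) :
  continuous f -> continuous g -> continuous (fun x => f x ⋅ g x).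
Proof.
move=> cf cg x; apply/cvg_rnormP => e e0.
pose M := rnorm (f x) + rnorm (g x) + 1.
have f0 := rnorm_ge0 (f x); have g0 := rnorm_ge0 (g x).
have M0 : 0 < M by rewrite /M; lra.
pose d := Num.min 1 (e / (2 * M)).
have d0 : 0 < d by rewrite lt_min ltr01 divr_gt0// mulr_gt0.
move/cvg_rnormP: (cf x) => /(_ _ d0); move/cvg_rnormP: (cg x) => /(_ _ d0).
apply: filterS2 => y; rewrite !lt_min => /andP[dg dge] /andP[df dfe].
have -> : f x ⋅ g x - f y ⋅ g y = f x ⋅ (g x - g y) + (f x - f y) ⋅ g y.
  by rewrite cmulBl cmulBr addrA subrK.
have M2 : e = M * (e / (2 * M)) + M * (e / (2 * M)).
  by field; rewrite gt_eqF.
apply: le_lt_trans (ler_rnormD _ _) _; rewrite [ltRHS]M2.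
apply: ltrD; apply: le_lt_trans (ler_rnormM _ _) _.
- apply: (@le_lt_trans _ _ (M * rnorm (g x - g y))).
    by apply: ler_wpM2r; [exact: rnorm_ge0 | rewrite /M; lra].
  by rewrite ltr_pM2l.
- rewrite mulrC; apply: (@le_lt_trans _ _ (M * rnorm (f x - f y))).
    apply: ler_wpM2r; first exact: rnorm_ge0.
    have := ler_dist_rnorm (g x) (g y).
    by rewrite ler_norml => /andP[]; rewrite /M; lra.
  by rewrite ltr_pM2l.
Qed.

Lemma continuous_cstar {X : topologicalType} (f : X -> A) :
  continuous f -> continuous (fun x => cstar (f x)).
Proof.
move=> cf x; apply/cvg_rnormP => e e0.
move/cvg_rnormP: (cf x) => /(_ _ e0).
by apply: filterS => y; rewrite -cstarN -cstarD rnorm_cstar.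
Qed.

End CStarBasics.

(** * Small square roots in the circle monoid *)

Section CircleMonoid.
Context (R : realType) (A : cstarAlgType R).
Implicit Types a b c m p q v w : A.
Local Notation "a ⋅ b" := (cmul a b) (at level 40, left associativity).

(** Multiplication of [1 + a] and [1 + b] in the unitization of [A], with the
    unit subtracted. *)
Definition circ a b := a + b + a ⋅ b.
Local Notation "a ∘ b" := (circ a b) (at level 45, left associativity).

Lemma circ0l a : 0 ∘ a = a.
Proof. by rewrite /circ cmul0l add0r addr0. Qed.

Lemma circ0r a : a ∘ 0 = a.
Proof. by rewrite /circ cmul0r !addr0. Qed.

Lemma circA a b c : a ∘ (b ∘ c) = a ∘ b ∘ c.
Proof.
rewrite /circ !cmulDl !cmulDr !cmulA.
rewrite -!addrA; congr (_ + (_ + _)).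
rewrite [RHS]addrCA; congr (_ + _).
by rewrite addrCA; congr (_ + _); rewrite addrCA.
Qed.

Lemma cstar_circ a b : cstar (a ∘ b) = cstar b ∘ cstar a.
Proof. by rewrite /circ !cstarD cstarM (addrC (cstar a)). Qed.

Lemma ler_rnorm_circ a b :
  rnorm (a ∘ b) <= rnorm a + rnorm b + rnorm a * rnorm b.
Proof.
apply: le_trans (ler_rnormD _ _) _.
by apply: lerD; [exact: ler_rnormD | exact: ler_rnormM].
Qed.

(** [v v - w w = (v - w) v + w (v - w)], so squaring in the circle monoid is
    doubling up to a term that is small with [v] and [w]; this is the source of
    uniqueness and continuity of small square roots. *)
Lemma circ_sqrB v w :
  (v - w) *+ 2 = v ∘ v - w ∘ w - ((v - w) ⋅ v + w ⋅ (v - w)).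
Proof.
have -> : (v - w) ⋅ v + w ⋅ (v - w) = v ⋅ v - w ⋅ w.
  by rewrite cmulBl cmulBr addrA subrK.
by apply/eqP; rewrite eq_sym subr_eq mulrnBl addrACA -opprD /circ -!mulr2n.
Qed.

Lemma ler_circ_sqr v w :
  rnorm (v - w) * (2 - (rnorm v + rnorm w)) <= rnorm (v ∘ v - w ∘ w).
Proof.
have : rnorm ((v - w) *+ 2) <= rnorm (v ∘ v - w ∘ w) +
    (rnorm (v - w) * rnorm v + rnorm w * rnorm (v - w)).
  rewrite circ_sqrB; apply: le_trans (ler_rnormB _ _) _; rewrite lerD2l.
  by apply: le_trans (ler_rnormD _ _) _; apply: lerD; exact: ler_rnormM.
rewrite rnormMn; lra.
Qed.

(** The bound [2] is the distance between the square roots [1] and [-1] of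
    [1]. *)
Lemma circ_sqr_inj v w :
  rnorm v + rnorm w < 2 -> v ∘ v = w ∘ w -> v = w.
Proof.
move=> vw2 vw; apply/eqP; rewrite -subr_eq0; apply/eqP/rnorm0_eq0.
have := ler_circ_sqr v w; rewrite vw subrr rnorm0.
rewrite pmulr_lle0 ?subr_gt0// => d0.
by apply/eqP; rewrite eq_le d0 rnorm_ge0.
Qed.

(** [w] is a square root of [m] when it is fixed by [w |-> (m - w w) / 2], which
    maps the ball of radius [1/10] to itself and contracts it. *)
Lemma circ_sqrt_exists m :
  rnorm m <= 10^-1 -> exists2 w, w ∘ w = m & rnorm w <= 10^-1.
Proof.
move=> m10; pose F w : A := (2^-1 : R)%:C%C *: (m - w ⋅ w).
have F2 v w : rnorm (F v - F w) <= (rnorm v + rnorm w) / 2 * rnorm (v - w).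
  rewrite -scalerBr rnormZ opprB addrC addrA subrK.
  have -> : w ⋅ w - v ⋅ v = (w - v) ⋅ w + v ⋅ (w - v).
    by rewrite cmulBl cmulBr addrA subrK.
  have := ler_rnormD ((w - v) ⋅ w) (v ⋅ (w - v)).
  have := ler_rnormM (w - v) w; have := ler_rnormM v (w - v).
  by rewrite (rnormB w v) ger0_norm ?invr_ge0//; lra.
have Fball w : rnorm w <= 10^-1 -> rnorm (F w) <= 10^-1.
  move=> w10; rewrite rnormZ ger0_norm ?invr_ge0//.
  have := ler_rnormB m (w ⋅ w); have := ler_rnormM w w.
  have := rnorm_ge0 w; nra.
pose u n := iter n F 0.
have u10 n : rnorm (u n) <= 10^-1.
  by elim: n => [|n IH] /=; rewrite ?rnorm0 ?invr_ge0//; exact: Fball.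
(* The contraction has ratio 1/10, whence a geometric rate; the weaker rate
   1/(n+1) is enough for Cauchy's criterion. *)
have u_close n k : rnorm (u (n + k)%N - u n) <= n.+1%:R^-1.
  elim: n => [|n IH].
    by rewrite add0n subr0 invr1; have := u10 k; lra.
  rewrite addSn /=; apply: le_trans (F2 _ _) _.
  have n0 : 0 <= n%:R :> R by [].
  have : n.+1%:R^-1 <= 2 * n.+2%:R^-1 :> R.
    by rewrite ler_pdivlMr// mulrC ler_pdivrMr// -!natr1; lra.
  have : (rnorm (u (n + k)%N) + rnorm (u n)) / 2 <= 10^-1.
    by have := u10 (n + k)%N; have := u10 n; lra.
  move=> /(ler_wpM2r (rnorm_ge0 (u (n + k)%N - u n))) h1 h2.
  move: (le_trans IH h2) (rnorm_ge0 (u (n + k)%N - u n)).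
  move: h1; set d := rnorm (u (n + k)%N - u n); set t := n.+2%:R^-1; lra.
have /cauchy_cvg cu : cauchy (u @ \oo).
  apply/cauchy_exP => -[e e'] /=; rewrite ltcE/= => /andP[/eqP -> e0].
  pose n := Num.bound e^-1; exists (u n), n => // k /= nk.
  rewrite -ball_normE/= rnormE ltcR rnormB -(subnKC nk).
  apply: le_lt_trans (u_close n _) _; rewrite invf_plt ?posrE//.
  apply: lt_le_trans (archi_boundP _) _; first by rewrite invr_ge0 ltW.
  by rewrite ler_nat.
pose l := lim (u @ \oo).
have ul : forall e : R, 0 < e -> \forall n \near \oo, rnorm (l - u n) < e.
  exact/cvg_rnormP.
have l10 : rnorm l <= 10^-1.
  apply/ler_addgt0Pr => e e0; near \oo => n.
  have : rnorm (l - u n) < e by near: n; exact: ul.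
  by have := ler_rnormD (l - u n) (u n); rewrite subrK; have := u10 n; lra.
exists l => //.
have Fl : F l = l.
  apply/eqP; rewrite -subr_eq0; apply/eqP/rnorm0_eq0/eqP.
  rewrite eq_le rnorm_ge0 andbT; apply/ler_addgt0Pr => e e0.
  have e2 : 0 < e / 2 by rewrite divr_gt0.
  have [n _ un] := ul _ e2.
  have h1 := un n (leqnn n); have h2 := un n.+1 (leqnSn n).
  rewrite add0r -[F l](subrK (u n.+1)) -addrA; apply: le_trans (ler_rnormD _ _) _.
  rewrite (rnormB _ l); have := F2 l (u n); rewrite -/(u n.+1) => h3.
  have : (rnorm l + rnorm (u n)) / 2 <= 1 by have := u10 n; lra.
  move=> /(ler_wpM2r (rnorm_ge0 (l - u n))) h4.
  by have := le_trans h3 h4; lra.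
have : F l *+ 2 = l *+ 2 by rewrite Fl.
rewrite -scaler_nat /F scalerA.
rewrite -(rmorph_nat (real_complex R)) -rmorphM mulfV ?pnatr_eq0// scale1r.
by move=> lm; rewrite /circ -mulr2n -lm subrK.
Unshelve. all: by end_near.
Qed.

End CircleMonoid.

(** * The unitary that turns a projection onto a close one *)

Section Turn.
Context (R : realType) (A : cstarAlgType R).
Implicit Types a b c m p q v w : A.
Local Notation "a ⋅ b" := (cmul a b) (at level 40, left associativity).
Local Notation "a ∘ b" := (circ a b) (at level 45, left associativity).

(** For a projection [p], this represents the self-adjoint unitary
    [1 - 2 p]. *)
Definition reflection p := - (p *+ 2).

Lemma circ_reflection p : p ⋅ p = p -> reflection p ∘ reflection p = 0.
Proof.
move=> pp; rewrite /circ /reflection cmulNl cmulNr opprK cmulMnl cmulMnr pp.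
by rewrite mulr2n addrA subrK addrC subrr.
Qed.

Lemma cstar_reflection p : cstar p = p -> cstar (reflection p) = reflection p.
Proof. by move=> ps; rewrite /reflection cstarN cstarMn ps. Qed.

Definition circ_unitary w := w ∘ cstar w = 0 /\ cstar w ∘ w = 0.

(** [(1 + w) a (1 + w)^*], an element of [A]; the factored form makes linearity
    immediate. *)
Definition uconj w a := let b := a + w ⋅ a in b + b ⋅ cstar w.

Lemma uconj0 a : uconj 0 a = a.
Proof. by rewrite /uconj cstar0 cmul0l cmul0r !addr0. Qed.

(** For unitary [1 + w], conjugating [1 + a] gives [1 + uconj w a]: conjugation
    in the circle monoid takes care of both the product and the adjoint of
    [A]. *)
Lemma uconjE w a : circ_unitary w -> w ∘ a ∘ cstar w = uconj w a.
Proof.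
case=> ww _; rewrite /uconj {1}/circ [w ∘ a]/circ -(addrA w).
move: (a + w ⋅ a) => b.
by rewrite cmulDl (addrAC w) addrACA -/(w ∘ cstar w) ww add0r.
Qed.

Lemma uconj_circ w a b : circ_unitary w ->
  uconj w (a ∘ b) = uconj w a ∘ uconj w b.
Proof.
move=> uw; rewrite -!uconjE// !circA; congr (_ ∘ _ ∘ _).
by rewrite -(circA _ (cstar w)) (proj2 uw) circ0r.
Qed.

Lemma uconjK w : circ_unitary w -> cancel (uconj w) (uconj (cstar w)).
Proof.
move=> uw a; have uw' : circ_unitary (cstar w).
  by case: uw; split; rewrite cstarK.
rewrite -!uconjE// !circA cstarK (proj2 uw) circ0l.
by rewrite -circA (proj2 uw) circ0r.
Qed.

Lemma uconj_linear w : linear (uconj w).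
Proof.
move=> k x y; rewrite /uconj !cmulDr !cmulZr addrACA -scalerDr.
by rewrite (cmulDl (k *: _)) cmulZl addrACA -scalerDr.
Qed.

Lemma uconj_reflection w p : uconj w (reflection p) = reflection (uconj w p).
Proof.
rewrite /reflection /uconj cmulNr cmulMnr -opprD -mulrnDl.
by rewrite cmulNl cmulMnl -opprD -mulrnDl.
Qed.

(** Multiplicativity follows from that for the circle operation, since
    [a b = (a ∘ b) - a - b] and [uconj w] is additive. *)
Lemma uconj_star_automorphism w :
  circ_unitary w -> is_star_automorphism (uconj w).
Proof.
move=> uw; split.
- exact: uconj_linear.
- move=> x y.
  have uD a b : uconj w (a + b) = uconj w a + uconj w b.
    by have := uconj_linear w 1 a b; rewrite !scale1r.
  have := uconj_circ x y uw; rewrite /circ !uD.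
  by move/addrI.
- by move=> x; rewrite -!uconjE// !cstar_circ cstarK circA.
- exists (uconj (cstar w)); first exact: uconjK.
  rewrite -{2}(cstarK w); apply: uconjK.
  by case: uw; split; rewrite cstarK.
Qed.

Definition is_proj p := p ⋅ p = p /\ cstar p = p.

(** The reflections in two lines at angle [theta] compose to the rotation by
    [2 theta], whose square root close to [1] is the rotation by [theta]. The
    radius [1/10] leaves room for the crude estimate of norms in
    [reflection_turn]. *)
Definition is_turn p q w :=
  w ∘ w = reflection q ∘ reflection p /\ rnorm w <= 10^-1.

Lemma rnorm_proj p : is_proj p -> rnorm p <= 1.
Proof.
case=> pp ps; have := rnorm_cstarM p; rewrite ps pp => p2.
have := rnorm_ge0 p; nra.
Qed.

(** [(1 - 2 q)(1 - 2 p) - 1 = 4 (q - p) p + 2 (p - q)] has norm at most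
    [6 |p - q|], and a square root is available up to norm [1/10]. *)
Lemma turn_exists p q : is_proj p -> is_proj q -> rnorm (p - q) <= 60^-1 ->
  exists w, is_turn p q w.
Proof.
move=> hp hq pq.
suff /circ_sqrt_exists[w] : rnorm (reflection q ∘ reflection p) <= 10^-1.
  by exists w.
have -> : reflection q ∘ reflection p = ((q - p) ⋅ p) *+ 4 + (p - q) *+ 2.
  rewrite /circ /reflection cmulNl cmulNr opprK cmulMnl cmulMnr -mulrnA cmulBl.
  rewrite (proj1 hp) !mulrnBl addrC -[RHS]addrA; congr (_ + _).
  by rewrite [RHS]addrA (mulrnDr p 2 2) (opprD (p *+ 2)) subrK addrC.
apply: le_trans (ler_rnormD _ _) _; rewrite !rnormMn.
have := ler_rnormM (q - p) p; have := rnorm_proj hp.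
rewrite (rnormB q); have := rnorm_ge0 p; have := rnorm_ge0 (p - q).
nra.
Qed.

Lemma turn_uniq p q v w : is_turn p q v -> is_turn p q w -> v = w.
Proof.
move=> [vv v10] [ww w10]; apply: circ_sqr_inj; last by rewrite vv ww.
lra.
Qed.

Lemma turn_refl p : is_proj p -> is_turn p p 0.
Proof.
move=> hp; split; last by rewrite rnorm0 invr_ge0.
by rewrite circ0l circ_reflection//; case: hp.
Qed.

Section TurnProperties.
Variables p q w : A.
Hypotheses (hp : is_proj p) (hq : is_proj q) (hw : is_turn p q w).

(** As [m = (1 - 2 q)(1 - 2 p)] is unitary, both [u^-1 = u m^*] and [u^*] are
    square roots of [m^*] close to [1], so they coincide. *)
Lemma turn_unitary : circ_unitary w.
Proof.
have [ww w10] := hw; have [pp ps] := hp; have [qq qs] := hq.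
set m := reflection q ∘ reflection p in ww.
pose m' := reflection p ∘ reflection q.
have mm' : m ∘ m' = 0.
  rewrite /m /m' circA -(circA (reflection q)).
  by rewrite circ_reflection// circ0r circ_reflection.
have m'm : m' ∘ m = 0.
  rewrite /m /m' circA -(circA (reflection p)).
  by rewrite circ_reflection// circ0r circ_reflection.
have m's : m' = cstar m by rewrite cstar_circ !cstar_reflection.
have wr : w ∘ (w ∘ m') = 0 by rewrite circA ww.
have wl : m' ∘ w ∘ w = 0 by rewrite -circA ww.
have wm' : m' ∘ w = w ∘ m' by rewrite -[LHS]circ0r -wr circA wl circ0l.
suff wV : w ∘ m' = cstar w by split; rewrite -wV ?wr// -wm' wl.
apply: circ_sqr_inj; last first.
  by rewrite -cstar_circ ww -m's -{1}wm' -circA wr circ0r.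
have := ler_rnorm_circ w w; have := ler_rnorm_circ w m'.
rewrite ww m's !rnorm_cstar; have := rnorm_ge0 w; have := rnorm_ge0 m.
nra.
Qed.

(** Conjugation by [1 - 2 p] turns [(1 - 2 q)(1 - 2 p)] into its adjoint, hence
    its small square root into the small square root of the adjoint. *)
Lemma reflection_turn : reflection p ∘ w ∘ reflection p = cstar w.
Proof.
have [ww w10] := hw; have [pp ps] := hp; have [qq qs] := hq.
have PP := circ_reflection pp.
apply: circ_sqr_inj; last first.
  rewrite -cstar_circ ww cstar_circ !cstar_reflection// !circA.
  rewrite -(circA _ (reflection p) (reflection p)) PP circ0r -(circA _ w w) ww.
  by rewrite -!circA PP circ0r.
(* As r has norm at most 2, the four terms below have norms at most 1, 2, 2
   and 4 times |w|; and 9/10 + 1/10 < 2. *)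
set r := reflection p in PP *.
have -> : r ∘ w ∘ r = w + r ⋅ w + (w ⋅ r + r ⋅ w ⋅ r).
  rewrite {1}/circ [r ∘ w]/circ -(addrA r) 2!cmulDl.
  move: (w + r ⋅ w) (w ⋅ r + r ⋅ w ⋅ r) => x y.
  by rewrite addrA (addrAC r) (addrAC _ x) -/(r ∘ r) PP add0r.
have p1 := rnorm_proj hp; have p0 := rnorm_ge0 p; have w0 := rnorm_ge0 w.
have r2 : rnorm r <= 2 by rewrite rnormN rnormMn; lra.
have r0 := rnorm_ge0 r.
have := ler_rnormD (w + r ⋅ w) (w ⋅ r + r ⋅ w ⋅ r).
have := ler_rnormD w (r ⋅ w); have := ler_rnormM r w.
have := ler_rnormD (w ⋅ r) (r ⋅ w ⋅ r).
have := ler_rnormM w r; have := ler_rnormM (r ⋅ w) r.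
have := rnorm_ge0 (r ⋅ w).
rewrite rnorm_cstar; nra.
Qed.

(** [u (1 - 2 p) u^* = u (1 - 2 p) (1 - 2 p) u (1 - 2 p) = u u (1 - 2 p)
    = 1 - 2 q]. *)
Lemma uconj_turn : uconj w p = q.
Proof.
have uw := turn_unitary; have [pp ps] := hp; have [qq qs] := hq.
have : uconj w (reflection p) = reflection q.
  rewrite -uconjE// -reflection_turn !circA.
  rewrite -(circA w (reflection p)) circ_reflection// circ0r (proj1 hw).
  by rewrite -circA circ_reflection// circ0r.
rewrite uconj_reflection => /oppr_inj.
rewrite -[LHS]scaler_nat -[RHS]scaler_nat; apply: scalerI.
by rewrite pnatr_eq0.
Qed.

End TurnProperties.

End Turn.

(** * Automorphisms are isometric *)

Section Contractive.
Context (R : realType) (A : cstarAlgType R).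
Implicit Types a : A.
Local Notation "a ⋅ b" := (cmul a b) (at level 40, left associativity).

(** The C*-identity improves any bound: if [|f a| <= s] on the unit ball, then
    [|f a|^2 = |f (a^* a)| <= s] there. For the optimal [s] this gives
    [s^2 <= s], hence [s <= 1]. *)
Lemma star_morphism_contractive (f : A -> A) :
  linear f -> {morph f : a b / a ⋅ b} -> {morph f : a / cstar a} ->
  continuous f -> forall a, rnorm (f a) <= rnorm a.
Proof.
move=> fl fM fS fc.
pose F : {linear A -> A} :=
  HB.pack_for {linear A -> A} f (GRing.isLinear.Build _ _ _ _ f fl).
have fZ (r : R) a : rnorm (f (r%:C%C *: a)) = `|r| * rnorm (f a).
  by rewrite -rnormZ -[f]/(F : A -> A) linearZ.
have [M fM1] : exists M : R, forall a, rnorm (f a) <= M * rnorm a.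
  have /linear_boundedP/filter_ex[r fr] : bounded_near F (nbhs 0).
    exact/linear_bounded_continuous.
  exists (complex.Re r) => a; have := fr a.
  by rewrite !rnormE lecE => /andP[_]; case: (r) => x y /=; rewrite mulr0 subr0.
pose S := [set rnorm (f a) | a in [set a | rnorm a <= 1]].
have supS : has_sup S.
  split; first by exists (rnorm (f 0)), 0 => //=; rewrite rnorm0.
  exists `|M| => _ [a /= a1 <-]; apply: le_trans (fM1 a) _.
  apply: le_trans (ler_wpM2r (rnorm_ge0 a) (ler_norm M)) _.
  by have := normr_ge0 M; have := rnorm_ge0 a; nra.
have S_sup a : rnorm a <= 1 -> rnorm (f a) <= sup S.
  by move=> a1; apply: ub_le_sup; [exact: (proj2 supS)|exists a].
have S1 : sup S <= 1.
  have s0 : 0 <= sup S by apply: le_trans (rnorm_ge0 _) (S_sup 0 _); rewrite rnorm0.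
  have : sup S <= Num.sqrt (sup S).
    apply: ge_sup; first exact: (proj1 supS).
    move=> _ [a /= a1 <-].
    rewrite -[leLHS]ger0_norm ?rnorm_ge0// -sqrtr_sqr ler_sqrt//.
    rewrite -rnorm_cstarM -fS -fM; apply: S_sup; rewrite rnorm_cstarM.
    by have := rnorm_ge0 a; nra.
  move: (sqr_sqrtr s0) (sqrtr_ge0 (sup S)).
  move: (Num.sqrt (sup S)) (sup S) => t s.
  by case: (lerP t 1); nra.
move=> a; have [->|a0] := eqVneq a 0.
  by rewrite (linear0 F : f 0 = 0) rnorm0.
have n0 : 0 < rnorm a.
  rewrite lt_neqAle rnorm_ge0 andbT eq_sym.
  by apply: contra_neq a0; exact: rnorm0_eq0.
have := S_sup ((rnorm a)^-1%:C%C *: a); rewrite rnormZ fZ.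
rewrite gtr0_norm ?invr_gt0// mulVf ?gt_eqF// => /(_ (lexx _)) => h.
by rewrite -[leRHS]mul1r -ler_pdivrMr// mulrC (le_trans h).
Qed.

End Contractive.

Section Isometric.
Context (R : realType) (gT : finGroupType) (A : gcstarAlgType R gT).

Lemma rnorm_gsact (g : gT) (a : A) : rnorm (gsact g a) = rnorm a.
Proof.
have H h (b : A) : rnorm (gsact h b) <= rnorm b.
  have [fl fM fS _] := @gsact_star_automorphism R gT A h.
  exact: star_morphism_contractive (gsact_continuous h) b.
by apply/eqP; rewrite eq_le H /= -{1}(gsactK g a) H.
Qed.

End Isometric.

(** * Rotating projections by automorphisms *)

Section Rotation.
Context (R : realType) (A : cstarAlgType R).
Local Notation "a ∘ b" := (circ a b) (at level 45, left associativity).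

(** The default value [0] gives the identity automorphism when [p] and [q] are
    too far apart, so that [rotate] is total. *)
Definition turn (p q : A) : A := xget 0 [set w | is_turn p q w].

Lemma turnE (p q w : A) : is_turn p q w -> turn p q = w.
Proof. by move=> hw; apply: xget_unique => // v hv; exact: turn_uniq hv hw. Qed.

Lemma turnP (p q : A) : is_proj p -> is_proj q -> rnorm (p - q) <= 60^-1 ->
  is_turn p q (turn p q).
Proof.
by move=> hp hq pq; have [w hw] := turn_exists hp hq pq; rewrite (turnE hw).
Qed.

Lemma uconj_turn_star_automorphism (p q : A) : is_proj p -> is_proj q ->
  is_star_automorphism (uconj (turn p q)).
Proof.
move=> hp hq; apply: uconj_star_automorphism; rewrite /turn.
case: xgetP => [w _ hw|_]; first exact: (turn_unitary hp hq).
by rewrite /circ_unitary cstar0 circ0l.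
Qed.

Lemma continuous_turn (X : topologicalType) (p q : X -> A) :
  continuous p -> continuous q ->
  (forall x, is_turn (p x) (q x) (turn (p x) (q x))) ->
  continuous (fun x => turn (p x) (q x)).
Proof.
move=> cp cq tpq.
have cm : continuous (fun x => reflection (q x) ∘ reflection (p x)).
  have cs (u : X -> A) : continuous u -> continuous (fun x => reflection (u x)).
    move=> cu x; apply: cvgN; apply: cvgD; exact: cu.
  move=> x; apply: cvgD; first by apply: cvgD; exact: cs.
  exact: (continuous_cmul (cs q cq) (cs p cp)).
move=> x; apply/cvg_rnormP => e e0; move/cvg_rnormP: (cm x) => /(_ _ e0).
apply: filterS => y; apply: le_lt_trans.
have [<- wx] := tpq x; have [<- wy] := tpq y.
apply: le_trans (ler_circ_sqr _ _); rewrite ler_peMr ?rnorm_ge0//.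
by lra.
Qed.

Lemma continuous_uconj (X : topologicalType) (w a : X -> A) :
  continuous w -> continuous a -> continuous (fun x => uconj (w x) (a x)).
Proof.
move=> cw ca.
have cb : continuous (fun x => a x + cmul (w x) (a x)).
  by move=> x; apply: cvgD; [exact: ca|exact: (continuous_cmul cw ca)].
move=> x; apply: cvgD; first exact: cb.
exact: (continuous_cmul cb (continuous_cstar cw)).
Qed.

Lemma turn_refl0 (p : A) : is_proj p -> turn p p = 0.
Proof. by move=> hp; apply/turnE/turn_refl. Qed.

Definition rotate (p q : Proj A) : StarAut A :=
  exist _ (uconj (turn (proj_val p) (proj_val q)))
    (mem_set (uconj_turn_star_automorphism (projP p) (projP q))).

Lemma rotate_refl p (a : A) : aut_val (rotate p p) a = a.
Proof. by rewrite /aut_val /= turn_refl0 ?uconj0//; exact: projP. Qed.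

Lemma rotate_proj p q : rnorm (proj_val p - proj_val q) <= 60^-1 ->
  aut_val (rotate p q) (proj_val p) = proj_val q.
Proof.
move=> pq; have hp := projP p; have hq := projP q.
exact: (uconj_turn hp hq (turnP hp hq pq)).
Qed.

Lemma continuous_rotate (X : topologicalType) (p q : X -> Proj A) (a : X -> A) :
  continuous p -> continuous q -> continuous a ->
  (forall x, rnorm (proj_val (p x) - proj_val (q x)) <= 60^-1) ->
  continuous (fun x => aut_val (rotate (p x) (q x)) (a x)).
Proof.
move=> cp cq ca pq; apply: continuous_uconj => //.
have cv (u : X -> Proj A) : continuous u -> continuous (fun x => proj_val (u x)).
  by move=> cu x; apply: continuous_comp; [exact: cu|exact: proj_val_continuous].
apply: continuous_turn; [exact: cv|exact: cv|] => x.
by apply: turnP => //; exact: projP.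
Qed.

End Rotation.

Section GTurn.
Context (R : realType) (gT : finGroupType) (A : gcstarAlgType R gT).

(** As [gsact g] is an isometric automorphism, it sends the small square root
    attached to [(p, q)] to a small square root attached to [(g p, g q)]. *)
Lemma gsact_rotate (g : gT) (p q : Proj A) (a : A) :
  rnorm (proj_val p - proj_val q) <= 60^-1 ->
  aut_val (rotate (gsact g p) (gsact g q)) (gsact g a) =
  gsact g (aut_val (rotate p q) a).
Proof.
move=> pq; have [fl fM fS _] := @gsact_star_automorphism R gT A g.
have fD (x y : A) : gsact g (x + y) = gsact g x + gsact g y.
  by have := fl 1 x y; rewrite !scale1r.
pose F : {linear A -> A} :=
  HB.pack_for {linear A -> A} (gsact g) (GRing.isLinear.Build _ _ _ _ _ fl).
have frefl (x : A) : gsact g (reflection x) = reflection (gsact g x).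
  by rewrite /reflection -[gsact g]/(F : A -> A) linearN linearMn.
have fcirc (x y : A) : gsact g (circ x y) = circ (gsact g x) (gsact g y).
  by rewrite /circ !fD fM.
have [ww w10] := turnP (projP p) (projP q) pq.
rewrite /aut_val /=.
have -> : turn (gsact g (proj_val p)) (gsact g (proj_val q)) =
    gsact g (turn (proj_val p) (proj_val q)).
  by apply: turnE; split; rewrite ?rnorm_gsact// -fcirc ww fcirc !frefl.
by rewrite /uconj -fS -!fM -!fD -fM -fD.
Qed.

End GTurn.

(** * A continuous step for families of paths *)

Lemma archi_bound_mul_ge1 (R : realType) (s : R) :
  0 < s -> 1 <= (Num.bound s^-1)%:R * s.
Proof.
move=> s0; rewrite -ler_pdivrMr// mul1r ltW// archi_boundP//.
by rewrite invr_ge0 ltW.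
Qed.

Lemma unitI_itv (R : realType) (t : unitI R) : 0 <= val t <= 1.
Proof. by have := set_mem (valP t); rewrite /= in_itv. Qed.

Section CompactInf.
Context (R : realType) (X K : topologicalType).
Hypothesis cK : compact [set: K].

(** The tube lemma, for the open set where [phi] differs from its values over
    [x0] by less than [e]. *)
Lemma compact_tube (phi : X * K -> R) (x0 : X) (e : R) :
  continuous phi -> 0 < e ->
  \forall x \near x0, forall k, `|phi (x0, k) - phi (x, k)| < e.
Proof.
move=> cphi e0; have e2 : 0 < e / 2 by rewrite divr_gt0.
have near_tube k : [set: K] k ->
    \forall k' \near k & x \near x0, `|phi (x0, k') - phi (x, k')| < e.
  move=> _; have /cvgrPdist_lt/(_ _ e2)[[U V] /= [Ux Vk] UV] := cphi (x0, k).
  exists (V, U) => //= -[k' x] /= [Vk' Ux'].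
  have h1 := UV (x, k') (conj Ux' Vk').
  have h2 := UV (x0, k') (conj (nbhs_singleton Ux) Vk').
  rewrite -(subrK (phi (x0, k)) (phi (x0, k'))) -addrA [e]splitr.
  apply: le_lt_trans (ler_normD _ _) _; rewrite ltrD//.
  by rewrite distrC.
have /compact_near_coveringP cov := cK.
have := cov _ (nbhs x0) (fun x k => `|phi (x0, k) - phi (x, k)| < e) _
  near_tube.
by move=> /(_ _); apply: filterS => x h k; exact: (h k Logic.I).
Qed.

Lemma compact_inf_continuous (phi : X * K -> R) (k0 : K) :
  continuous phi -> (forall z, 0 <= phi z) ->
  continuous (fun x => inf (range (fun k => phi (x, k)))).
Proof.
move=> cphi phi0 x; apply/cvgrPdist_le => e e0.
apply: filterS (compact_tube x cphi e0) => y h.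
have H z : has_lbound (range (fun k => phi (z, k))).
  by exists 0 => _ [k _ <-].
have H0 z : range (fun k => phi (z, k)) !=set0 by exists (phi (z, k0)), k0.
have B z k : inf (range (fun k => phi (z, k))) <= phi (z, k).
  by apply: ge_inf => //; exists k.
have inf_le z z' : (forall k, `|phi (z, k) - phi (z', k)| < e) ->
    inf (range (fun k => phi (z, k))) - e <= inf (range (fun k => phi (z', k))).
  move=> zz'; apply: lb_le_inf => // _ [k _ <-].
  have := zz' k; rewrite ltr_norml => /andP[_]; have := B z k.
  move: (inf _) => s; lra.
have := inf_le x y h; have := inf_le y x (fun k => _).
move=> /(_ (fun k => eq_ind_r (fun t => t < e) (h k) (distrC _ _))).
move: (inf _) (inf _) => s t h1 h2.
by rewrite ler_norml; apply/andP; split; lra.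
Qed.

End CompactInf.

Lemma compact_inf_gt0 (R : realType) (K : topologicalType) (phi : K -> R)
    (k0 : K) : compact [set: K] -> continuous phi -> (forall k, 0 < phi k) ->
  0 < inf (range phi).
Proof.
move=> cK cphi phi0.
have near_low k : [set: K] k ->
    \forall k' \near k & r \near (0:R)^'+, r <= phi k'.
  move=> _; have k2 : 0 < phi k / 2 by rewrite divr_gt0.
  have /cvgrPdist_lt/(_ _ k2) hk := cphi k.
  exists ([set k' | `|phi k - phi k'| < phi k / 2], [set r | r <= phi k / 2]).
    by split=> //=; exact: nbhs_right_le.
  move=> [k' r] /= [+ rk]; rewrite ltr_norml => /andP[_ +].
  by rewrite ltrBlDl -ltrBlDr => h; lra.
have /compact_near_coveringP cov := cK.
have low := cov _ (0:R)^'+ (fun r k => r <= phi k) _ near_low.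
near (0:R)^'+ => r.
have r0 : 0 < r by [].
apply: lt_le_trans r0 _; apply: lb_le_inf; first by exists (phi k0), k0.
move=> _ [k _ <-].
suff : [set: K] `<=` (fun k => r <= phi k) by apply.
by near: r; exact: low.
Unshelve. all: by end_near.
Qed.

Lemma compact_unitI (R : realType) : compact [set: unitI R].
Proof.
have -> : [set: unitI R] = @clamp R @` `[0, 1].
  apply/seteqP; split=> // t _; exists (val t); first exact: set_mem (valP t).
  by apply: val_inj; apply: clampK; have := set_mem (valP t); rewrite /= in_itv.
apply: continuous_compact; last exact: segment_compact.
exact/continuous_subspaceT/clamp_continuous.
Qed.

Section Mesh.
Context (R : realType) (X : topologicalType) (V : normedModType R[i]).
Context (eps : R) (H : X * unitI R -> V).
Hypotheses (eps0 : 0 < eps) (cH : continuous H).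

(** A number that is at most the spread of [(s, t)] and larger than [|s - t|]
    forces the values of [H] at [s] and [t] to be [eps]-close. The maximum keeps
    the spread positive on the diagonal and off it. *)
Definition spread (z : X * (unitI R * unitI R)) : R :=
  Num.max `|val z.2.1 - val z.2.2|
    (eps - rnorm (H (z.1, z.2.1) - H (z.1, z.2.2))).

Definition mesh (x : X) : R := inf (range (fun st => spread (x, st))).

Lemma spread_continuous : continuous spread.
Proof.
have cval (f : X * (unitI R * unitI R) -> unitI R) : continuous f ->
    continuous (fun z => val (f z)).
  move=> cf z; apply: (@continuous_comp _ (unitI R) R f val); first exact: cf.
  exact: unitI_val_continuous.
have c1 : continuous (fun z : X * (unitI R * unitI R) => z.2.1).
  by move=> z; exact: (cvg_comp _ _ cvg_snd cvg_fst).
have c2 : continuous (fun z : X * (unitI R * unitI R) => z.2.2).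
  by move=> z; exact: (cvg_comp _ _ cvg_snd cvg_snd).
have cHf (f : X * (unitI R * unitI R) -> unitI R) : continuous f ->
    continuous (fun z => H (z.1, f z)).
  move=> cf z; apply: (@continuous_comp _ (X * unitI R)%type V
    (fun z => (z.1, f z)) H); last exact: cH.
  exact: (cvg_pair cvg_fst (cf z)).
have cdt : continuous (fun z : X * (unitI R * unitI R) =>
    `|val z.2.1 - val z.2.2|).
  by move=> z; apply: cvg_norm; apply: cvgB; exact: cval.
have cdH : continuous (fun z : X * (unitI R * unitI R) =>
    eps - rnorm (H (z.1, z.2.1) - H (z.1, z.2.2))).
  move=> z; apply: cvgB; first exact: cvg_cst.
  have cd : continuous (fun z : X * (unitI R * unitI R) =>
      H (z.1, z.2.1) - H (z.1, z.2.2)).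
    by move=> {}z; apply: cvgB; exact: cHf.
  exact: (continuous_rnorm cd).
by move=> z; exact: (continuous_max (cdt z) (cdH z)).
Qed.

Lemma spread_gt0 z : 0 < spread z.
Proof.
case: z => x [s t]; rewrite /spread /= lt_max.
have [->|st] := eqVneq s t; first by rewrite !subrr rnorm0 subr0 eps0 orbT.
by rewrite normr_gt0 subr_eq0 (inj_eq val_inj) st.
Qed.

Lemma mesh_continuous : continuous mesh.
Proof.
apply: (@compact_inf_continuous _ _ _ _ _ (zero, zero)).
- by rewrite -setXTT; exact: (compact_setX (@compact_unitI R) (@compact_unitI R)).
- exact: spread_continuous.
- by move=> z; rewrite ltW// spread_gt0.
Qed.

Lemma mesh_gt0 x : 0 < mesh x.
Proof.
apply: (compact_inf_gt0 (zero, zero)).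
- by rewrite -setXTT; exact: (compact_setX (@compact_unitI R) (@compact_unitI R)).
- move=> st; apply: (@continuous_comp _ (X * (unitI R * unitI R))%type R
    (fun st => (x, st)) spread); last exact: spread_continuous.
  exact: (cvg_pair (cvg_cst _) cvg_id).
- by move=> st; exact: spread_gt0.
Qed.

Lemma mesh_close x s t : `|val s - val t| < mesh x ->
  rnorm (H (x, s) - H (x, t)) <= eps.
Proof.
move=> st; have : mesh x <= spread (x, (s, t)).
  apply: ge_inf; last by exists (s, t).
  by exists 0 => _ [k _ <-]; rewrite ltW// spread_gt0.
rewrite /spread /= le_max leNgt st /= => h.
by have := mesh_gt0 x; lra.
Qed.

Lemma mesh_eq x y :
  (forall s t, rnorm (H (x, s) - H (x, t)) = rnorm (H (y, s) - H (y, t))) ->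
  mesh x = mesh y.
Proof.
move=> xy; rewrite /mesh.
suff -> : (fun st => spread (x, st)) = (fun st => spread (y, st)) by [].
by apply/funext => st; rewrite /spread /= xy.
Qed.

End Mesh.

(** * Lifting a homotopy step by step *)

Section AutComp.
Context (R : realType) (A : cstarAlgType R).

Fact aut_comp_subproof (b c : StarAut A) :
  aut_val b \o aut_val c \in [set f : {ptws A -> A} | is_star_automorphism f].
Proof.
have [l1 m1 s1 b1] := autP b; have [l2 m2 s2 b2] := autP c.
apply/mem_set; split.
- by move=> k x y /=; rewrite l2 l1.
- by move=> x y /=; rewrite m2 m1.
- by move=> x /=; rewrite s2 s1.
- exact: bij_comp.
Qed.

Definition aut_comp (b c : StarAut A) : StarAut A :=
  exist _ (aut_val b \o aut_val c) (aut_comp_subproof b c).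

Lemma aut_ext (b c : StarAut A) :
  (forall a, aut_val b a = aut_val c a) -> b = c.
Proof. by move=> bc; apply/aut_inj/funext. Qed.

End AutComp.

Section Lift.
Context (R : realType) (gT : finGroupType) (A : gcstarAlgType R gT).
Context (X : gSpaceType gT) (q : Proj A).
Context (f : X -> StarAut A) (P : cylinder R X -> Proj A).
Hypotheses (f_gmap : is_gmap f) (P_gmap : is_gmap P).
Hypothesis Pf : forall x, P (x, zero) = ev_proj q (f x).

Let eps60 : 0 < 60^-1 :> R. Proof. by rewrite invr_gt0. Qed.

Let p (z : X * unitI R) : A := proj_val (P z).

Let p_continuous : continuous p.
Proof.
move=> z; apply: (@continuous_comp (X * unitI R)%type (Proj A) A P).
  exact: (proj1 P_gmap).
exact: proj_val_continuous.
Qed.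

(** Half of the mesh, for [mesh_close] needs a strict inequality. *)
Definition step_size (x : X) : R := mesh 60^-1 p x / 2.

Lemma step_size_gt0 x : 0 < step_size x.
Proof. by rewrite divr_gt0// mesh_gt0. Qed.

Lemma step_size_continuous : continuous step_size.
Proof.
by move=> x; apply: cvgM; [exact: mesh_continuous|exact: cvg_cst].
Qed.

Lemma step_size_gsact g x : step_size (gsact g x) = step_size x.
Proof.
have [fl _ _ _] := @gsact_star_automorphism R gT A g.
have fB (a b : A) : gsact g (a - b) = gsact g a - gsact g b.
  by rewrite addrC -scaleN1r fl scaleN1r addrC.
have pg y s : p (gsact g y, s) = gsact g (p (y, s)).
  by rewrite /p -[(gsact g y, s)]/(gsact g ((y, s) : cylinder R X)) (proj2 P_gmap).
congr (_ / 2); apply: mesh_eq => s t.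
by rewrite !pg -fB rnorm_gsact.
Qed.

Definition breakpoint (n : nat) (z : X * unitI R) : unitI R :=
  clamp (Num.min (n%:R * step_size z.1) (val z.2)).

Lemma val_breakpoint n z :
  val (breakpoint n z) = Num.min (n%:R * step_size z.1) (val z.2).
Proof.
have /andP[t0 t1] := unitI_itv z.2.
have s0 : 0 <= n%:R * step_size z.1 by rewrite mulr_ge0// ltW// step_size_gt0.
by rewrite clampK// le_min s0 t0 ge_min t1 orbT.
Qed.

Lemma breakpoint0 z : breakpoint 0 z = zero.
Proof.
apply: val_inj; rewrite val_breakpoint mul0r; apply/min_idPl.
by have /andP[] := unitI_itv z.2.
Qed.

Lemma breakpoint_end n z : 1 <= n%:R * step_size z.1 -> breakpoint n z = z.2.
Proof.
move=> n1; apply: val_inj; rewrite val_breakpoint; apply/min_idPr.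
by apply: le_trans n1; have /andP[] := unitI_itv z.2.
Qed.

Lemma breakpoint_zero n x : breakpoint n (x, zero) = zero.
Proof.
apply: val_inj; rewrite val_breakpoint /=; apply/min_idPr.
by rewrite mulr_ge0// ltW// step_size_gt0.
Qed.

Lemma breakpoint_continuous n : continuous (breakpoint n).
Proof.
have c1 : continuous (fun z : X * unitI R => n%:R * step_size z.1).
  have cs : continuous (fun z : X * unitI R => step_size z.1).
    by move=> z; apply: (cvg_comp _ _ cvg_fst); exact: step_size_continuous.
  by move=> z; apply: cvgM; [exact: cvg_cst|exact: cs].
have c2 : continuous (fun z : X * unitI R => val z.2).
  by move=> z; apply: (cvg_comp _ _ cvg_snd); exact: unitI_val_continuous.
have c3 : continuous (fun z : X * unitI R =>
    Num.min (n%:R * step_size z.1) (val z.2)).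
  by move=> z; exact: (continuous_min (c1 z) (c2 z)).
have cc := @clamp_continuous R.
by move=> z; exact: (cvg_comp _ _ (c3 z) (cc _)).
Qed.

Lemma breakpoint_close n z :
  rnorm (p (z.1, breakpoint n z) - p (z.1, breakpoint n.+1 z)) <= 60^-1.
Proof.
apply: mesh_close => //.
rewrite !val_breakpoint -natr1 mulrDl mul1r.
rewrite -[ltRHS](divfK (_ : 2 != 0)) ?pnatr_eq0// -/(step_size z.1).
move: (step_size z.1) (step_size_gt0 z.1) (val z.2) => s s0 t; move: (_ * s) => a.
by rewrite ltr_norml; case: (ltP a t); case: (ltP (a + s) t) => ? ?;
  apply/andP; split; lra.
Qed.

(** Transport of [f z.1] along the path [P (z.1, -)] through the first [n]
    breakpoints. *)
Fixpoint stepwise_lift (n : nat) (z : X * unitI R) : StarAut A :=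
  if n is m.+1 then
    aut_comp (rotate (P (z.1, breakpoint m z)) (P (z.1, breakpoint m.+1 z)))
      (stepwise_lift m z)
  else f z.1.

Lemma stepwise_lift_stationary n z :
  breakpoint n z = breakpoint n.+1 z ->
  stepwise_lift n.+1 z = stepwise_lift n z.
Proof.
by move=> nz; apply: aut_ext => a; rewrite /aut_val/= nz [LHS]rotate_refl.
Qed.

Lemma stepwise_lift_zero n x : stepwise_lift n (x, zero) = f x.
Proof.
by elim: n => // n IH; rewrite stepwise_lift_stationary ?breakpoint_zero.
Qed.

Lemma stepwise_lift_stable n m z : 1 <= n%:R * step_size z.1 ->
  stepwise_lift (n + m) z = stepwise_lift n z.
Proof.
move=> n1; have end_le k : breakpoint (n + k) z = z.2.
  apply: breakpoint_end; apply: le_trans n1 _.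
  by rewrite ler_wpM2r ?ler_nat// ?leq_addr// ltW// step_size_gt0.
elim: m => [|m IH]; first by rewrite addn0.
by rewrite addnS stepwise_lift_stationary// -addnS !end_le.
Qed.

Lemma stepwise_lift_proj n z :
  ev_proj q (stepwise_lift n z) = P (z.1, breakpoint n z).
Proof.
elim: n => [|n IH]; first by rewrite breakpoint0 Pf.
apply: proj_inj; rewrite -(rotate_proj (breakpoint_close n z)).
exact: (congr1 (fun r => aut_val (rotate _ _) (proj_val r)) IH).
Qed.

Lemma stepwise_lift_continuous n : continuous (stepwise_lift n).
Proof.
have c1 : continuous (fst : X * unitI R -> X) by move=> z; exact: cvg_fst.
have cP k : continuous (fun z => P (z.1, breakpoint k z)).
  move=> z; apply: (@continuous_comp _ (X * unitI R)%type (Proj A)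
    (fun z => (z.1, breakpoint k z)) P); last exact: (proj1 P_gmap).
  exact: (cvg_pair (c1 z) (@breakpoint_continuous k z)).
elim: n => [|n IH].
  by move=> z; apply: (cvg_comp _ _ (c1 z)); exact: (proj1 f_gmap).
apply: continuous_to_aut => a.
apply: (@continuous_rotate _ _ _ _ _ (fun z => aut_val (stepwise_lift n z) a)).
- exact: cP.
- exact: cP.
- have ce := @aut_eval_continuous R A a.
  by move=> z; exact: (cvg_comp _ _ (IH z) (ce _)).
- exact: breakpoint_close.
Qed.

Lemma stepwise_lift_gsact n g (z : cylinder R X) :
  stepwise_lift n (gsact g z) = gsact g (stepwise_lift n z).
Proof.
have breakpoint_g k : breakpoint k (gsact g z) = breakpoint k z.
  by rewrite /breakpoint /= step_size_gsact.
have P_g k : P (gsact g z.1, breakpoint k z) = gsact g (P (z.1, breakpoint k z)).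
  exact: (proj2 P_gmap g (z.1, breakpoint k z)).
elim: n => [|n IH]; first exact: (proj2 f_gmap).
apply: aut_ext => a; rewrite [stepwise_lift n.+1 _]/= !breakpoint_g !P_g IH.
rewrite [LHS](gsact_rotate _ _ (breakpoint_close n z)).
by [].
Qed.

(** The number of steps suffices to reach the end of the unit interval. It is
    not continuous in [z], but by [homotopy_liftE] any larger number gives the
    same value. *)
Definition homotopy_lift (z : X * unitI R) : StarAut A :=
  stepwise_lift (Num.bound (step_size z.1)^-1) z.

Lemma homotopy_liftE n z : 1 <= n%:R * step_size z.1 ->
  homotopy_lift z = stepwise_lift n z.
Proof.
move=> n1; rewrite /homotopy_lift; set m := Num.bound _.
have m1 : 1 <= m%:R * step_size z.1.
  by apply: archi_bound_mul_ge1; exact: step_size_gt0.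
have [nm|/ltnW mn] := leqP n m.
  by rewrite -(subnKC nm) stepwise_lift_stable.
by rewrite -(subnKC mn) stepwise_lift_stable.
Qed.

Lemma homotopy_lift_continuous : continuous homotopy_lift.
Proof.
move=> z; have s0 := step_size_gt0 z.1.
have s2 : 0 < step_size z.1 / 2 by rewrite divr_gt0.
(* Near z the step stays larger than half of its value at z, so that n steps
   suffice on a whole neighborhood of z. *)
pose n := Num.bound (step_size z.1 / 2)^-1.
have near_n : \forall y \near z, stepwise_lift n y = homotopy_lift y.
  have cs : continuous (fun y : X * unitI R => step_size y.1).
    by move=> y; apply: (cvg_comp _ _ cvg_fst); exact: step_size_continuous.
  have /cvgrPdist_lt/(_ _ s2) := cs z.
  apply: filterS => y; rewrite ltr_norml => /andP[_ sy].
  apply/esym/homotopy_liftE; apply: le_trans (archi_bound_mul_ge1 s2) _.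
  by rewrite ler_wpM2l//; lra.
have nz : homotopy_lift z = stepwise_lift n z by exact/esym/(nbhs_singleton near_n).
rewrite /continuous_at nz.
apply: cvg_trans (@stepwise_lift_continuous n z).
exact: near_eq_cvg.
Qed.

Lemma homotopy_lift_proj z : ev_proj q (homotopy_lift z) = P z.
Proof.
rewrite stepwise_lift_proj breakpoint_end ?archi_bound_mul_ge1 ?step_size_gt0//.
by case: z.
Qed.

Lemma homotopy_lift_zero x : homotopy_lift (x, zero) = f x.
Proof. exact: stepwise_lift_zero. Qed.

Lemma homotopy_lift_gmap :
  is_gmap (homotopy_lift : cylinder R X -> StarAut A).
Proof.
split=> [|g z]; first exact: homotopy_lift_continuous.
rewrite /homotopy_lift -stepwise_lift_gsact.
by rewrite -[(gsact g z).1]/(gsact g z.1) step_size_gsact.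
Qed.

End Lift.

Theorem lemmaA3 (R : realType) (gT : finGroupType) (A : gcstarAlgType R gT)
    (q0 : Proj A) (q0_fixed : forall g : gT, gsact g q0 = q0) :
  is_hurewicz_gfibration R
    (Xi q0 : StarAut A -> GProj_sub (ev_pi0_image_invariant q0_fixed)).
Proof.
split.
  split.
    apply: (@continuous_comp_initial _ _ _
      (set_val : GProj_sub (ev_pi0_image_invariant q0_fixed) -> Proj A)).
    exact: ev_proj_continuous.
  by move=> g b; apply: val_inj; rewrite /= gsact_ev_proj.
move=> X f H fG [cH HG] Hf.
pose P (z : cylinder R X) : Proj A := val (H z).
have PG : is_gmap P.
  split=> [z|g z]; last by rewrite /P HG.
  apply: (@continuous_comp (cylinder R X)
    (GProj_sub (ev_pi0_image_invariant q0_fixed)) (Proj A) H val).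
    exact: cH.
  exact: (@initial_continuous _ _
    (set_val : GProj_sub (ev_pi0_image_invariant q0_fixed) -> Proj A)).
have Pf x : P (x, zero) = ev_proj q0 (f x) by rewrite /P Hf.
exists (homotopy_lift f P); split.
- exact: homotopy_lift_gmap.
- exact: homotopy_lift_zero.
- by move=> z; apply: val_inj; exact: (homotopy_lift_proj PG Pf).
Qed.
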